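(* Let $(u_h,w_h,g_h,z_h,\widehat u_h,\widehat w_h,\widehat g_h,\widehat z_h)$ be a semidiscrete solution on $[0,T]$ of the HDG scheme described in the context, with boundary datum $U_b$. Then, for all $t\in[0,T]$, $$\frac12\frac{d}{dt}\|u_h(t)\|_{\mathcal T_h}^2+\mathcal D_h(t)\le\frac14U_b(t)^2+\frac14\bigl(1-g_h(t,0)\bigr),$$ where $$\mathcal D_h(t):=\frac14g_h(t,0)\,u_h(t,0)^2+\frac14\tilde g_h(t,b)\bigl(u_h(t,b)-U_b(t)\bigr)^2+\frac14\sum_{i=1}^{N-1}\tilde g_h(t,r_i)\bigl(u_h|_{I_i}(r_i)(t)-\widehat u_h(r_i)(t)\bigr)^2\ge0.$$
   Context: Let $b>0$, $T>0$ and let $0=r_0<r_1<\dots<r_N=b$ be a partition of $[0,b]$, $I_i=(r_{i-1},r_i)$, $i=1,\dots,N$, $\mathcal T_h=\{I_i\}_{i=1}^N$. For an integer $k\ge0$, $P^k(I_i)$ denotes the polynomials of degree at most $k$ on $I_i$ and $V_h^k=\{v\in L^2(0,b): v|_{I_i}\in P^k(I_i),\ i=1,\dots,N\}$. The value $v|_{I_i}(r_j)$, $j\in\{i-1,i\}$, is the one-sided value taken from within $I_i$; $u_h(t,0)$ and $u_h(t,b)$ are the values from within $I_1$ and $I_N$. Write $(v_1,v_2)_{I_i}=\int_{I_i}v_1v_2\,dr$, $\|v\|_{\mathcal T_h}^2=\sum_{i=1}^N(v,v)_{I_i}$, and $\langle\psi,\eta\,n\rangle_{\partial I_i}=\psi(r_i)\eta(r_i)-\psi(r_{i-1})\eta(r_{i-1})$,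 with values taken from within $I_i$. Subscripts $r,t$ denote partial derivatives ($r$-derivatives are taken elementwise). Semidiscrete HDG scheme with boundary datum $U_b:[0,T]\to\mathbb R$: a semidiscrete solution on $[0,T]$ consists of $u_h\in C^1([0,T];V_h^k)$ and, for each $t$, trace values $\widehat u_h,\widehat g_h$ at the nodes $r_1,\dots,r_N$ and $\widehat w_h,\widehat z_h$ at the nodes $r_0,\dots,r_{N-1}$, such that the following hold at each $t$. (1) Local reconstruction: for $r\in I_i$ (up to the endpoints), $$w_h(r)=\widehat w_h(r_{i-1})+\int_{r_{i-1}}^r u_h(s)\,ds,$$ $$g_h(r)=\widehat g_h(r_i)\exp\Bigl(-\int_r^{r_i}\frac1s\bigl(u_h(s)-\tilde u_h(s)\bigr)^2ds\Bigr),$$ $$z_h(r)=\widehat z_h(r_{i-1})+\int_{r_{i-1}}^r g_h(s)\,ds,$$ where $\tilde u_h(r)=w_h(r)/r$ and $\tilde g_h(r)=z_h(r)/r$ for $r>0$, $\tilde u_h(0):=u_h(0)$ and $\tilde g_h(0):=g_h(0)$. (2) Local evolution equation: for every $i$ and all $\phi_u\in P^k(I_i)$, $$\bigl((u_h)_t,\phi_u\bigr)_{I_i}+\Bigl(\tfrac12\tilde g_hu_h,(\phi_u)_r\Bigr)_{I_i}-\bigl\langle\widehat{\mathcal F}_{u,h},\phi_u\,n\bigr\rangle_{\partial I_i}+\Bigl(\tfrac12(\tilde g_h)_r\tilde u_h,\phi_u\Bigr)_{I_i}=0,$$ with numerical flux on $I_i$ given by $\widehat{\mathcal F}_{u,h}(r_i)=\tfrac12\tilde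 g_h(r_i)\widehat u_h(r_i)$ and $\widehat{\mathcal F}_{u,h}(r_{i-1})=\tfrac12\tilde g_h(r_{i-1})u_h(r_{i-1})$ (values of $\tilde g_h$, $u_h$ taken from within $I_i$). (3) Transmission conditions for $i=1,\dots,N-1$: $\widehat{\mathcal F}_{u,h}|_{I_i}(r_i)=\widehat{\mathcal F}_{u,h}|_{I_{i+1}}(r_i)$, $w_h|_{I_i}(r_i)=w_h|_{I_{i+1}}(r_i)$, $z_h|_{I_i}(r_i)=z_h|_{I_{i+1}}(r_i)$, $g_h|_{I_i}(r_i)=g_h|_{I_{i+1}}(r_i)$. (4) Boundary data: $\widehat u_h(t,b)=U_b(t)$, $\widehat g_h(t,b)=1$, $\widehat w_h(t,0)=0$, $\widehat z_h(t,0)=0$. *)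

(* Defs.v *)
From Stdlib Require Import Reals.
From Coquelicot Require Import Coquelicot.
Open Scope R_scope.

(* Derivative of [f] at [t] relative to [D]; one-sided at the ends of an
   interval [D]. *)
Definition is_derive_within (D : R -> Prop) (f : R -> R) (t l : R) : Prop :=
  filterdiff f (within D (locally t)) (fun h : R => scal h l).

Definition time_interval (T t : R) : Prop := 0 <= t <= T.

Definition is_C1_on (D : R -> Prop) (f f' : R -> R) : Prop :=
  (forall t, D t -> is_derive_within D f t (f' t)) /\ continuous_on D f'.

Definition partition (b : R) (N : nat) (r : nat -> R) : Prop :=
  (1 <= N)%nat /\ r 0%nat = 0 /\ r N = b /\
  forall i, (1 <= i <= N)%nat -> r (i - 1)%nat < r i.

(* The polynomial of degree at most [k] with coefficients [c 0], ..., [c k]. *)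
Definition pol (k : nat) (c : nat -> R) (x : R) : R :=
  sum_n (fun j => c j * x ^ j) k.

(* Elements are numbered i = 1, ..., N as I_i = (r (i-1), r i).  Elementwise
   quantities [q] are written [q t i x] and regarded as functions on the closed
   element, so that the value at a node taken from within I_i is [q t i (r i)]
   or [q t i (r (i-1))].  Node quantities are written [q t i] for the node r i.
   A function of V_h^k is stored as its coefficients on each element;
   V_h^k being finite-dimensional, u_h is C^1 in time iff these are. *)
Record hdg_data : Type := {
  uc : R -> nat -> nat -> R;       (* coefficients of u_h *)
  utc : R -> nat -> nat -> R;      (* coefficients of (u_h)_t *)
  wh : R -> nat -> R -> R;
  gh : R -> nat -> R -> R;
  zh : R -> nat -> R -> R;
  u_hat : R -> nat -> R;
  w_hat : R -> nat -> R;
  g_hat : R -> nat -> R;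
  z_hat : R -> nat -> R
}.

Definition uh (k : nat) (S : hdg_data) (t : R) (i : nat) (x : R) : R :=
  pol k (uc S t i) x.

Definition uh_t (k : nat) (S : hdg_data) (t : R) (i : nat) (x : R) : R :=
  pol k (utc S t i) x.

Definition u_tilde (k : nat) (S : hdg_data) (t : R) (i : nat) (x : R) : R :=
  if Rlt_dec 0 x then wh S t i x / x else uh k S t i x.

Definition g_tilde (S : hdg_data) (t : R) (i : nat) (x : R) : R :=
  if Rlt_dec 0 x then zh S t i x / x else gh S t i x.

Definition flux_right (r : nat -> R) (S : hdg_data) (t : R) (i : nat) : R :=
  / 2 * g_tilde S t i (r i) * u_hat S t i.

Definition flux_left (k : nat) (r : nat -> R) (S : hdg_data) (t : R) (i : nat)
  : R :=
  / 2 * g_tilde S t i (r (i - 1)%nat) * uh k S t i (r (i - 1)%nat).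

Definition inner (r : nat -> R) (i : nat) (v1 v2 : R -> R) : R :=
  RInt (fun x => v1 x * v2 x) (r (i - 1)%nat) (r i).

(* All integrands below are continuous on the closed elements (on I_1 because
   w_h and z_h vanish at 0), except that the value at an endpoint of the [Derive]
   in the evolution equation is meaningless; this does not affect [RInt]. *)

Definition local_reconstruction (k N : nat) (r : nat -> R) (S : hdg_data)
    (t : R) : Prop :=
  forall i, (1 <= i <= N)%nat -> forall x, r (i - 1)%nat <= x <= r i ->
    wh S t i x
      = w_hat S t (i - 1)%nat + RInt (fun s => uh k S t i s) (r (i - 1)%nat) x
    /\ gh S t i x
      = g_hat S t i
        * exp (- RInt (fun s => / s * (uh k S t i s - u_tilde k S t i s) ^ 2)
                      x (r i))
    /\ zh S t i x
      = z_hat S t (i - 1)%nat + RInt (fun s => gh S t i s) (r (i - 1)%nat) x.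

Definition local_evolution (k N : nat) (r : nat -> R) (S : hdg_data)
    (t : R) : Prop :=
  forall i, (1 <= i <= N)%nat -> forall c : nat -> R,
    let phi := pol k c in
    inner r i (uh_t k S t i) phi
    + inner r i (fun x => / 2 * g_tilde S t i x * uh k S t i x) (Derive phi)
    - (flux_right r S t i * phi (r i)
       - flux_left k r S t i * phi (r (i - 1)%nat))
    + inner r i
        (fun x => / 2 * Derive (g_tilde S t i) x * u_tilde k S t i x) phi
    = 0.

Definition transmission (k N : nat) (r : nat -> R) (S : hdg_data)
    (t : R) : Prop :=
  forall i, (1 <= i <= N - 1)%nat ->
    flux_right r S t i = flux_left k r S t (i + 1)%nat
    /\ wh S t i (r i) = wh S t (i + 1)%nat (r i)
    /\ zh S t i (r i) = zh S t (i + 1)%nat (r i)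
    /\ gh S t i (r i) = gh S t (i + 1)%nat (r i).

Definition boundary_data (N : nat) (Ub : R -> R) (S : hdg_data)
    (t : R) : Prop :=
  u_hat S t N = Ub t /\ g_hat S t N = 1
  /\ w_hat S t 0%nat = 0 /\ z_hat S t 0%nat = 0.

Definition semidiscrete_solution (T : R) (k N : nat) (r : nat -> R)
    (Ub : R -> R) (S : hdg_data) : Prop :=
  (forall i j, (1 <= i <= N)%nat -> (j <= k)%nat ->
     is_C1_on (time_interval T) (fun t => uc S t i j) (fun t => utc S t i j))
  /\ forall t, time_interval T t ->
       local_reconstruction k N r S t /\ local_evolution k N r S t
       /\ transmission k N r S t /\ boundary_data N Ub S t.

Definition norm2_Th (k N : nat) (r : nat -> R) (S : hdg_data) (t : R) : R :=
  sum_n_m (fun i => inner r i (uh k S t i) (uh k S t i)) 1 N.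

(* At an interior node g_tilde is single-valued by the transmission condition
   on z_h; its value is taken from the left element. *)
Definition dissipation (k N : nat) (r : nat -> R) (Ub : R -> R) (S : hdg_data)
    (t : R) : R :=
  / 4 * gh S t 1%nat 0 * uh k S t 1%nat 0 ^ 2
  + / 4 * g_tilde S t N (r N) * (uh k S t N (r N) - Ub t) ^ 2
  + / 4 * sum_n_m (fun i => g_tilde S t i (r i)
                            * (uh k S t i (r i) - u_hat S t i) ^ 2) 1 (N - 1).

(* Main.v *)
Require Import Defs.
From Stdlib Require Import Reals Lra Lia.
From Coquelicot Require Import Coquelicot.
Open Scope R_scope.

(** Fix a time and write [u, w, g, z, ut, gt] for [u_h, w_h, g_h, z_h, u_tilde,
    g_tilde].  The scheme is tested with [u] on each element.  Differentiating
    the reconstruction formulas gives, for [x > 0],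
    [x gt' = g - gt] and [x g' = g (u - ut)^2].  Hence, pointwise,
    [2 gt u u' + 2 gt' ut u
       = (gt u^2 - g)' + gt' ut^2 + gt (u - ut)^2 / x],
    and the last two terms are nonnegative because [0 <= gt <= g]
    ([prim_metric_bounds]).  Integration over the element bounds the volume
    terms of the scheme below by the increment of [(gt u^2 - g) / 4]
    ([element_energy]).  The boundary values of [gt u^2] combine with the
    numerical flux into the squared jump [gt (u - u_hat)^2 / 4] at the right end
    and [gt u^2 / 4] at the left end ([element_estimate]).

    Summation over the elements telescopes: the flux condition gives
    [gt u_hat^2 = gt u^2] across each interior node, and [g] is continuous there
    ([energy_up_to_node]).  What remains is the dissipation, the term
    [gt(b) Ub^2 / 4], which is at most [Ub^2 / 4] since [gt(b) <= g(b) = 1], and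
    [(1 - g(0)) / 4].

    Two signs have to be propagated through the mesh: [g >= 0] inwards from the
    outer boundary ([g_hat_nonneg]) and [0 <= z <= x g] outwards from the centre
    ([element_estimates]).  On the first element the integrals also require
    continuity of [gt'] and [(u - ut)^2 / x] at [x = 0].  Both follow from one fact
    about means: if [h] is differentiable at [0], then [h] minus its mean over
    [(0, x)], divided by [x], has a limit as [x] tends to [0]
    ([continuous_slope]). *)

(** * Means over intervals starting at the singular point *)

(** For [a > 0] the quotients by [x] are well behaved on the half line [x > 0];
    for [a = 0] the element touches the singular point, but there the quotients
    extend continuously to the whole line.  In both cases [dom a] is an open
    interval containing every element with left end [a], so that two-sided
    continuity and derivatives are available at the ends of the element. *)
Definition dom (a x : R) : Prop := 0 < x \/ a = 0.

Definition prim (a c : R) (h : R -> R) (x : R) : R := c + RInt h a x.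

(** For [a = c = 0] this is the mean of [h] over [(0, x)], with the value [h 0]
    at the singular point; [avg] turns [u_h] into [u_tilde] and [g_h] into
    [g_tilde]. *)
Definition avg (a c : R) (h : R -> R) (x : R) : R :=
  if Rlt_dec 0 x then prim a c h x / x else h x.

(** The derivative of [avg a c h] on [x > 0].  The value at [0] is its limit there
    when [a = c = 0]. *)
Definition slope (a c : R) (h : R -> R) (x : R) : R :=
  if Rlt_dec 0 x then (h x - avg a c h x) / x else Derive h 0 / 2.

Lemma dom_locally a x : dom a x -> locally x (dom a).
Proof.
  intros [Hx|Ha].
  - exists (mkposreal x Hx); intros y Hy; left.
    unfold ball in Hy; simpl in Hy; unfold AbsRing_ball, abs, minus, plus, opp in Hy; simpl in Hy.
    apply Rabs_def2 in Hy; lra.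
  - exists (mkposreal 1 Rlt_0_1); intros y _; now right.
Qed.

Lemma dom_between a x y z : dom a x -> dom a y -> Rmin x y <= z -> dom a z.
Proof.
  intros [Hx|Ha] [Hy|Ha'] Hz; try (now right).
  left; pose proof (Rmin_glb_lt x y 0 Hx Hy); lra.
Qed.

Lemma ex_RInt_dom a (h : R -> R) x y :
  (forall z, dom a z -> continuous h z) -> dom a x -> dom a y -> ex_RInt h x y.
Proof.
  intros Hh Hx Hy; apply (@ex_RInt_continuous R_CompleteNormedModule).
  intros z [Hz _]; apply Hh; now apply (dom_between a x y).
Qed.

Lemma dom_element a x : 0 <= a <= x -> dom a x.
Proof. intros H; destruct (Req_dec a 0); [now right | left; lra]. Qed.

Lemma is_derive_prim a c (h : R -> R) x :
  0 <= a -> (forall z, dom a z -> continuous h z) -> dom a x ->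
  is_derive (prim a c h) x (h x).
Proof.
  intros Ha Hh Hx.
  replace (h x) with (plus (zero : R) (h x)) by apply plus_zero_l.
  apply (is_derive_plus (fun _ => c) (RInt h a)); [apply (is_derive_const c x)|].
  apply is_derive_RInt with (a := a); [|now apply Hh].
  generalize (dom_locally a x Hx); apply filter_imp; intros y Hy.
  apply (@RInt_correct R_CompleteNormedModule), (ex_RInt_dom a); auto.
  apply dom_element; lra.
Qed.

Lemma is_derive_continuous (f : R -> R) x l : is_derive f x l -> continuous f x.
Proof. intros H; apply (@ex_derive_continuous R_AbsRing); now exists l. Qed.

Lemma continuous_glue (f g : R -> R) x :
  (0 < x -> continuous f x) -> (x <= 0 -> continuous g x) ->
  (x = 0 -> filterlim f (at_right 0) (locally (g 0))) ->
  continuous (fun y => if Rlt_dec 0 y then f y else g y) x.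
Proof.
  intros Hf Hg H0.
  destruct (Rtotal_order 0 x) as [Hx|[Hx|Hx]].
  - apply continuous_ext_loc with f; [|auto].
    apply (filter_imp (fun y => 0 < y)); [|now apply (open_gt 0)].
    intros y Hy; destruct (Rlt_dec 0 y); [reflexivity | contradiction].
  - subst x. unfold continuous. destruct (Rlt_dec 0 0) as [H|_]; [lra|].
    intros P HP.
    pose proof (H0 eq_refl P HP) as H1; pose proof (Hg (Rle_refl 0) P HP) as H2.
    unfold filtermap, at_right, within in *.
    generalize (filter_and _ _ H1 H2); apply filter_imp.
    intros y [Hy1 Hy2]; destruct (Rlt_dec 0 y); auto.
  - apply continuous_ext_loc with g; [|apply Hg; lra].
    apply (filter_imp (fun y => y < 0)); [|now apply (open_lt 0)].
    intros y Hy; destruct (Rlt_dec 0 y); [lra | reflexivity].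
Qed.

Lemma filterlim_at_right_0 (f : R -> R) l :
  (forall eps : posreal, exists d : posreal,
      forall x, 0 < x < d -> Rabs (f x - l) < eps) ->
  filterlim f (at_right 0) (locally l).
Proof.
  intros H; apply filterlim_locally; intros eps.
  destruct (H eps) as [d Hd]; exists d; intros y Hy Hy0.
  apply Hd; split; auto.
  unfold ball in Hy; simpl in Hy; unfold AbsRing_ball, abs, minus, plus, opp in Hy; simpl in Hy.
  apply Rabs_def2 in Hy; lra.
Qed.

(** At [0], the mean value theorem writes the mean over [(0, y)] as [h z] with
    [z] between [0] and [y]. *)
Lemma continuous_avg a c (h : R -> R) x :
  0 <= a -> (a = 0 -> c = 0) -> (forall z, dom a z -> continuous h z) ->
  dom a x -> continuous (avg a c h) x.
Proof.
  intros Ha Hc Hh Hx; unfold avg.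
  apply (continuous_glue (fun y => prim a c h y / y) h x).
  - intros Hx0; apply (continuous_mult (prim a c h) Rinv).
    + eapply is_derive_continuous, is_derive_prim; eauto.
    + apply continuous_Rinv; lra.
  - intros _; auto.
  - intros ->. assert (Ha0 : a = 0) by (destruct Hx; lra).
    specialize (Hc Ha0); subst a c.
    apply filterlim_at_right_0; intros eps.
    destruct (proj1 (filterlim_locally _ _) (Hh 0 (or_intror eq_refl)) eps) as [d Hd].
    exists d; intros y Hy.
    destruct (MVT_gen (prim 0 0 h) 0 y h) as [z [Hz E]].
    + intros; apply is_derive_prim; auto; now right.
    + intros; apply continuity_pt_filterlim.
      eapply is_derive_continuous, is_derive_prim; auto; now right.
    + rewrite Rmin_left, Rmax_right in Hz by lra.
      assert (E0 : prim 0 0 h 0 = 0).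
      { unfold prim; rewrite RInt_point; apply Rplus_0_l. }
      replace (prim 0 0 h y / y) with (h z) by (rewrite E0 in E; field_simplify_eq; lra).
      apply Hd. unfold ball; simpl; unfold AbsRing_ball, abs, minus, plus, opp; simpl.
      apply Rabs_def1; lra.
Qed.

(** Near [0], if [h y = h 0 + l y + o(y)] then the mean of [h] over [(0, y)] is
    [h 0 + l y / 2 + o(y)], so their difference divided by [y] tends to
    [l / 2]. *)
Lemma continuous_slope a c (h : R -> R) x :
  0 <= a -> (a = 0 -> c = 0) -> (forall z, dom a z -> continuous h z) ->
  (a = 0 -> ex_derive h 0) ->
  dom a x -> continuous (slope a c h) x.
Proof.
  intros Ha Hc Hh Hd Hx; unfold slope.
  apply (continuous_glue (fun y => (h y - avg a c h y) / y) (fun _ => Derive h 0 / 2) x).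
  - intros Hx0; apply (continuous_mult (fun y => h y - avg a c h y) Rinv).
    + apply (continuous_minus h (avg a c h)); [auto | now apply continuous_avg].
    + apply continuous_Rinv; lra.
  - intros _; apply continuous_const.
  - intros ->. assert (Ha0 : a = 0) by (destruct Hx; lra).
    specialize (Hc Ha0); specialize (Hd Ha0); subst a c.
    set (l := Derive h 0).
    apply filterlim_at_right_0; intros eps.
    assert (He : 0 < eps / 4) by (destruct eps; simpl; lra).
    apply Derive_correct in Hd; destruct Hd as [_ Hd].
    specialize (Hd 0 (fun P H => H) (mkposreal _ He)); destruct Hd as [d Hd].
    assert (Hd' : forall y, 0 <= y < d -> Rabs (h y - h 0 - l * y) <= eps / 4 * y).
    { intros y Hy. specialize (Hd y).
      assert (B : ball 0 d y).
      { unfold ball; simpl; unfold AbsRing_ball, abs, minus, plus, opp; simpl.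
        apply Rabs_def1; lra. }
      specialize (Hd B).
      unfold norm, minus, plus, opp, scal in Hd; simpl in Hd; unfold abs, mult in Hd; simpl in Hd.
      fold l in Hd.
      replace (h y - h 0 - l * y) with (h y + - h 0 + - ((y + - 0) * l)) by ring.
      rewrite (Rabs_pos_eq (y + - 0)) in Hd by lra; lra. }
    exists d; intros y Hy.
    (* The error of the integral is [y] times an error of [h], by the mean
       value theorem applied to the primitive of the remainder of [h]. *)
    destruct (MVT_gen (fun z => prim 0 0 h z - h 0 * z - l * z ^ 2 / 2) 0 y
                (fun z => h z - h 0 - l * z)) as [z [Hz E]].
    + intros z _. assert (P := is_derive_prim 0 0 h z (Rle_refl 0) Hh (or_intror eq_refl)).
      auto_derive; [now exists (h z)|].
      replace (Derive _ z) with (h z) by (symmetry; now apply is_derive_unique); field.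
    + intros z _; apply continuity_pt_filterlim.
      assert (P := is_derive_prim 0 0 h z (Rle_refl 0) Hh (or_intror eq_refl)).
      apply (ex_derive_continuous (fun z => prim 0 0 h z - h 0 * z - l * z ^ 2 / 2)).
      auto_derive; now exists (h z).
    + rewrite Rmin_left, Rmax_right in Hz by lra.
      assert (E0 : prim 0 0 h 0 = 0).
      { unfold prim; rewrite RInt_point; apply Rplus_0_l. }
      rewrite E0 in E.
      unfold avg; destruct (Rlt_dec 0 y) as [_|]; [|lra].
      assert (Q1 := Hd' y ltac:(lra)); assert (Q2 := Hd' z ltac:(lra)).
      replace ((h y - prim 0 0 h y / y) / y - l / 2)
        with (((h y - h 0 - l * y) - (h z - h 0 - l * z)) / y)
        by (field_simplify_eq; nra).
      assert (0 < eps) by (destruct eps; simpl; lra).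
      unfold Rdiv; rewrite Rabs_mult, (Rabs_pos_eq (/ y))
        by (left; apply Rinv_0_lt_compat; lra).
      apply Rmult_lt_reg_r with y; [lra|].
      rewrite Rmult_assoc, Rinv_l, Rmult_1_r by lra.
      apply Rle_lt_trans with (eps / 4 * y + eps / 4 * y); [|nra].
      eapply Rle_trans; [apply Rabs_triang|]. rewrite Rabs_Ropp. nra.
Qed.

Lemma is_derive_avg a c (h : R -> R) x :
  0 <= a -> (forall z, dom a z -> continuous h z) -> 0 < x ->
  is_derive (avg a c h) x (slope a c h x).
Proof.
  intros Ha Hh Hx.
  apply is_derive_ext_loc with (fun y => prim a c h y / y).
  - apply (filter_imp (fun y => 0 < y)); [|now apply (open_gt 0)].
    intros y Hy; unfold avg; destruct (Rlt_dec 0 y); [reflexivity | contradiction].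
  - assert (P := is_derive_prim a c h x Ha Hh (or_introl Hx)).
    unfold slope, avg; destruct (Rlt_dec 0 x); [|contradiction].
    auto_derive; [split; [now exists (h x) | lra]|].
    replace (Derive _ x) with (h x) by (symmetry; now apply is_derive_unique); field; lra.
Qed.

Lemma nondecreasing_on (f df : R -> R) a b :
  a <= b -> (forall x, a < x < b -> is_derive f x (df x)) ->
  (forall x, a <= x <= b -> continuous f x) ->
  (forall x, a < x < b -> 0 <= df x) -> f a <= f b.
Proof.
  intros Hab Hd Hc Hp.
  (* [MVT_gen] may return an end of the interval, where [df] has no sign; the
     positive part of [df] is an equally good derivative inside. *)
  destruct (MVT_gen f a b (fun x => Rmax (df x) 0)) as [c [_ E]];
    rewrite ?Rmin_left, ?Rmax_right in * by lra.
  - intros x Hx; rewrite Rmax_left; auto.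
  - intros x Hx; apply continuity_pt_filterlim, Hc; auto.
  - pose proof (Rmax_r (df c) 0); nra.
Qed.

(** * The reconstructed metric function on one element *)

(** The logarithmic derivative of [g_h]. *)
Definition deviation (a wa : R) (u : R -> R) (s : R) : R :=
  / s * (u s - avg a wa u s) ^ 2.

(** The function [g_h] on the element [(a, b)], with right trace [gb]. *)
Definition metric (a b wa gb : R) (u : R -> R) (x : R) : R :=
  gb * exp (- RInt (deviation a wa u) x b).

(** The factor [1 / s] is harmless at the singular point: the deviation from the
    mean is of order [s], so its square absorbs it. *)
Lemma deviation_slope a wa u x :
  deviation a wa u x = Rmax 0 x * slope a wa u x ^ 2.
Proof.
  unfold deviation, slope; destruct (Rlt_dec 0 x) as [Hx|Hx].
  - rewrite Rmax_right by lra; field; lra.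
  - rewrite Rmax_left by lra; unfold avg; destruct (Rlt_dec 0 x); [lra|ring].
Qed.

Lemma deviation_nonneg a wa u x : 0 <= deviation a wa u x.
Proof. rewrite deviation_slope; apply Rmult_le_pos; [apply Rmax_l | apply pow2_ge_0]. Qed.

Lemma continuous_sqr (f : R -> R) x : continuous f x -> continuous (fun y => f y ^ 2) x.
Proof.
  intros Hf; apply (continuous_ext (fun y => mult (f y) (f y))).
  - intros y; unfold mult; simpl; ring.
  - now apply (continuous_mult f f).
Qed.

Lemma continuous_deviation a wa (u : R -> R) x :
  0 <= a -> (a = 0 -> wa = 0) -> (forall z, ex_derive u z) ->
  dom a x -> continuous (deviation a wa u) x.
Proof.
  intros Ha Hw Hu Hx.
  assert (Hc : forall z, dom a z -> continuous u z)
    by (intros; now apply (ex_derive_continuous u)).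
  apply (continuous_ext (fun y => mult (Rmax 0 y) (slope a wa u y ^ 2)));
    [intros; symmetry; apply deviation_slope|].
  apply (continuous_mult (fun y => Rmax 0 y)).
  - apply (continuous_ext (fun y => (y + Rabs y) / 2)).
    { intros y; unfold Rmax, Rabs; destruct (Rle_dec 0 y), (Rcase_abs y); lra. }
    apply (continuous_mult (fun y => y + Rabs y) (fun _ => / 2)); [|apply continuous_const].
    apply (continuous_plus (fun y => y) Rabs); [apply continuous_id | apply continuous_Rabs].
  - now apply continuous_sqr, continuous_slope.
Qed.

Lemma is_derive_metric a b wa gb (u : R -> R) x :
  0 <= a <= b -> (a = 0 -> wa = 0) -> (forall z, ex_derive u z) -> dom a x ->
  is_derive (metric a b wa gb u) x (metric a b wa gb u x * deviation a wa u x).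
Proof.
  intros Hab Hw Hu Hx.
  assert (Hc : forall z, dom a z -> continuous (deviation a wa u) z)
    by (intros; now apply continuous_deviation).
  set (I := (fun y => RInt (deviation a wa u) y b) : R -> R).
  assert (P : is_derive I x (- deviation a wa u x)).
  { apply (is_derive_RInt' (deviation a wa u) I x b); [|now apply Hc].
    generalize (dom_locally a x Hx); apply filter_imp; intros y Hy.
    apply (@RInt_correct R_CompleteNormedModule), (ex_RInt_dom a); auto.
    now apply dom_element. }
  change (is_derive (fun y => gb * exp (- I y)) x
            (gb * exp (- I x) * deviation a wa u x)).
  (* Opaque, so that [auto_derive] does not differentiate the integral itself. *)
  clearbody I.
  auto_derive; [now exists (- deviation a wa u x)|].
  replace (Derive _ x) with (- deviation a wa u x)
    by (symmetry; now apply is_derive_unique); ring.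
Qed.

Lemma metric_nonneg a b wa gb u x : 0 <= gb -> 0 <= metric a b wa gb u x.
Proof. intros H; apply Rmult_le_pos; [auto | left; apply exp_pos]. Qed.

(** This gives [0 <= g_tilde <= g]: the primitive [z] of [g >= 0] is
    nondecreasing, and so is [x g - z], whose derivative [x g'] is
    nonnegative. *)
Lemma prim_metric_bounds a b wa gb za (u : R -> R) x :
  0 <= a -> (a = 0 -> wa = 0) -> (forall z, ex_derive u z) -> 0 <= gb ->
  0 <= za <= a * metric a b wa gb u a -> a <= x <= b ->
  0 <= prim a za (metric a b wa gb u) x <= x * metric a b wa gb u x.
Proof.
  intros Ha Hw Hu Hgb Hza Hx.
  set (g := metric a b wa gb u) in *.
  assert (Hg : forall y, dom a y -> is_derive g y (g y * deviation a wa u y))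
    by (intros; apply is_derive_metric; auto; lra).
  assert (Hgc : forall y, dom a y -> continuous g y)
    by (intros; eapply is_derive_continuous; eauto).
  assert (Hz : forall y, dom a y -> is_derive (prim a za g) y (g y))
    by (intros; now apply is_derive_prim).
  assert (Ea : prim a za g a = za).
  { unfold prim; rewrite RInt_point; apply Rplus_0_r. }
  assert (Hdom : forall y, a <= y -> dom a y) by (intros; now apply dom_element).
  split.
  - apply Rle_trans with (prim a za g a); [lra|].
    apply (nondecreasing_on (prim a za g) g); [lra| | |].
    + intros; apply Hz, Hdom; lra.
    + intros; eapply is_derive_continuous, Hz, Hdom; lra.
    + intros; now apply metric_nonneg.
  - enough (a * g a - prim a za g a <= x * g x - prim a za g x) by lra.
    assert (Hd : forall y, a <= y ->
              is_derive (fun y => y * g y - prim a za g y) y (y * (g y * deviation a wa u y))).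
    { intros y Hy; pose proof (Hg y (Hdom y Hy)) as P; pose proof (Hz y (Hdom y Hy)) as Q.
      auto_derive.
      { repeat split; auto; [now exists (g y * deviation a wa u y) | now exists (g y)]. }
      replace (Derive (fun x => g x) y) with (g y * deviation a wa u y)
        by (symmetry; now apply is_derive_unique).
      replace (Derive _ y) with (g y)
        by (symmetry; now apply is_derive_unique). ring. }
    apply (nondecreasing_on (fun y => y * g y - prim a za g y)
             (fun y => y * (g y * deviation a wa u y))); [lra| | |].
    + intros; apply Hd; lra.
    + intros; eapply is_derive_continuous, Hd; lra.
    + intros; apply Rmult_le_pos; [lra|].
      apply Rmult_le_pos; [now apply metric_nonneg | apply deviation_nonneg].
Qed.

(** Half of the fundamental theorem of calculus, with nothing asked of the
    derivative of [f] at the ends, where [g_tilde] need not have one. *)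
Lemma increment_le_RInt a b (f df h : R -> R) :
  0 <= a <= b -> (forall x, dom a x -> continuous h x) ->
  (forall x, a < x < b -> is_derive f x (df x)) ->
  (forall x, a <= x <= b -> continuous f x) ->
  (forall x, a < x < b -> df x <= h x) ->
  f b - f a <= RInt h a b.
Proof.
  intros Hab Hh Hf Hfc Hle.
  assert (P : forall x, a <= x -> is_derive (prim a 0 h) x (h x)).
  { intros; apply is_derive_prim; auto; [lra | apply dom_element; lra]. }
  enough (prim a 0 h a - f a <= prim a 0 h b - f b) as H.
  { unfold prim in H; rewrite RInt_point in H.
    change (@zero R_CompleteNormedModule) with 0 in H; lra. }
  apply (nondecreasing_on (fun x => prim a 0 h x - f x) (fun x => h x - df x)); [lra| | |].
  - intros x Hx; apply (is_derive_minus (prim a 0 h) f); [apply P; lra | auto].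
  - intros x Hx; apply (continuous_minus (prim a 0 h) f); [|auto].
    eapply is_derive_continuous, P; lra.
  - intros x Hx; specialize (Hle x Hx); lra.
Qed.

(** The integral form of the pointwise inequality
    [(g_tilde u^2 - g)' <= 2 g_tilde u u' + 2 g_tilde' u_tilde u].
    The right side minus the left side is
    [g_tilde' u_tilde^2 - g_tilde' (u - u_tilde)^2 + g'], and inserting
    [x g_tilde' = g - g_tilde] and [x g' = g (u - u_tilde)^2] leaves
    [g_tilde' u_tilde^2 + g_tilde (u - u_tilde)^2 / x >= 0]. *)
Lemma element_energy a b wa gb za (u : R -> R) :
  0 <= a < b -> (a = 0 -> wa = 0) -> (forall x, ex_derive u x) ->
  (forall x, continuous (Derive u) x) -> 0 <= gb ->
  0 <= za <= a * metric a b wa gb u a ->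
  let g := metric a b wa gb u in
  / 4 * (avg a za g b * u b ^ 2 - avg a za g a * u a ^ 2 - (g b - g a))
  <= RInt (fun x => / 2 * avg a za g x * u x * Derive u x) a b
     + RInt (fun x => / 2 * slope a za g x * avg a wa u x * u x) a b.
Proof.
  intros Hab Hw Hu Hu' Hgb Hza g.
  assert (Ha : 0 <= a) by lra.
  assert (Hz0 : a = 0 -> za = 0) by (intros ->; lra).
  assert (Hg : forall x, dom a x -> is_derive g x (g x * deviation a wa u x))
    by (intros; apply is_derive_metric; auto; lra).
  assert (Cg : forall x, dom a x -> continuous g x)
    by (intros; eapply is_derive_continuous; eauto).
  assert (Cu : forall x, dom a x -> continuous u x)
    by (intros; now apply (ex_derive_continuous u)).
  assert (Cgt : forall x, dom a x -> continuous (avg a za g) x)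
    by (intros; now apply continuous_avg).
  assert (Cut : forall x, dom a x -> continuous (avg a wa u) x)
    by (intros; now apply continuous_avg).
  assert (Cd : forall x, dom a x -> continuous (slope a za g) x).
  { intros; apply continuous_slope; auto.
    intros Ha0; exists (g 0 * deviation a wa u 0); apply Hg; now right. }
  assert (C1 : forall x, dom a x ->
            continuous (fun x => / 2 * avg a za g x * u x * Derive u x) x).
  { intros x Hx.
    apply (continuous_mult (fun x => / 2 * avg a za g x * u x) (Derive u)); auto.
    apply (continuous_mult (fun x => / 2 * avg a za g x) u); auto.
    apply (continuous_mult (fun _ => / 2) (avg a za g)); auto.
    apply continuous_const. }
  assert (C2 : forall x, dom a x ->
            continuous (fun x => / 2 * slope a za g x * avg a wa u x * u x) x).
  { intros x Hx.
    apply (continuous_mult (fun x => / 2 * slope a za g x * avg a wa u x) u); auto.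
    apply (continuous_mult (fun x => / 2 * slope a za g x) (avg a wa u)); auto.
    apply (continuous_mult (fun _ => / 2) (slope a za g)); auto.
    apply continuous_const. }
  assert (Da : dom a a) by (apply dom_element; lra).
  assert (Db : dom a b) by (apply dom_element; lra).
  assert (Dx : forall x, a <= x -> dom a x) by (intros; apply dom_element; lra).
  rewrite <- (RInt_plus (V := R_CompleteNormedModule)) by (now apply (ex_RInt_dom a)).
  set (E := fun x => / 4 * (avg a za g x * u x ^ 2 - g x)).
  replace (/ 4 * _) with (E b - E a) by (unfold E; ring).
  apply (increment_le_RInt a b E
    (fun x => / 4 * (slope a za g x * u x ^ 2 + avg a za g x * (2 * u x * Derive u x)
                     - g x * deviation a wa u x))); [lra| | | |].
  - intros x Hx.
    apply (continuous_plus (fun x => / 2 * avg a za g x * u x * Derive u x)); auto.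
  - intros x Hx.
    assert (P := is_derive_avg a za g x Ha Cg ltac:(lra)).
    assert (Q := Hg x ltac:(apply Dx; lra)).
    unfold E; auto_derive.
    { repeat split; auto; [now exists (slope a za g x) | now exists (g x * deviation a wa u x)]. }
    replace (Derive (fun x => avg a za g x) x) with (slope a za g x)
      by (symmetry; now apply is_derive_unique).
    replace (Derive (fun x => g x) x) with (g x * deviation a wa u x)
      by (symmetry; now apply is_derive_unique).
    change (Derive (fun x => u x) x) with (Derive u x). ring.
  - intros x Hx; unfold E.
    apply (continuous_mult (fun _ => / 4) (fun x => avg a za g x * u x ^ 2 - g x));
      [apply continuous_const|].
    apply (continuous_minus (fun x => avg a za g x * u x ^ 2) g); [|apply Cg, Dx; lra].
    apply (continuous_mult (avg a za g) (fun x => u x ^ 2)); [apply Cgt, Dx; lra|].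
    apply continuous_sqr, Cu, Dx; lra.
  - intros x Hx; unfold plus; simpl.
    pose proof (prim_metric_bounds a b wa gb za u x Ha Hw Hu Hgb Hza ltac:(lra)) as [Z0 Z1].
    fold g in Z0, Z1.
    assert (Hx0 : 0 < x) by lra.
    assert (G0 : 0 <= avg a za g x).
    { unfold avg; destruct (Rlt_dec 0 x); [|contradiction].
      apply Rmult_le_pos; [auto | left; now apply Rinv_0_lt_compat]. }
    assert (S0 : 0 <= slope a za g x).
    { unfold slope, avg; destruct (Rlt_dec 0 x); [|contradiction].
      apply Rmult_le_pos; [|left; now apply Rinv_0_lt_compat].
      enough (prim a za g x / x <= g x) by lra.
      apply Rmult_le_reg_r with x; [auto|]. field_simplify; lra. }
    assert (ES : g x = avg a za g x + x * slope a za g x).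
    { unfold slope; destruct (Rlt_dec 0 x); [field; lra | contradiction]. }
    assert (EP : x * deviation a wa u x = (u x - avg a wa u x) ^ 2)
      by (unfold deviation; field; lra).
    pose proof (deviation_nonneg a wa u x) as P0.
    pose proof (Rmult_le_pos _ _ S0 (pow2_ge_0 (avg a wa u x))).
    pose proof (Rmult_le_pos _ _ G0 P0).
    assert (EQ : g x * deviation a wa u x = avg a za g x * deviation a wa u x
                 + slope a za g x * (u x - avg a wa u x) ^ 2) by (rewrite ES, <- EP; ring).
    rewrite EQ.
    nra.
Qed.

(** * Time derivative of the energy *)

Lemma is_derive_within_plus D f g t l m :
  is_derive_within D f t l -> is_derive_within D g t m ->
  is_derive_within D (fun s => f s + g s) t (l + m).
Proof.
  unfold is_derive_within; intros Hf Hg.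
  eapply filterdiff_ext_lin; [apply (filterdiff_plus_fct f g); eassumption|].
  intros y; unfold plus, scal; simpl; unfold mult; simpl; ring.
Qed.

Lemma is_derive_within_const (D : R -> Prop) c t : is_derive_within D (fun _ => c) t 0.
Proof.
  unfold is_derive_within.
  eapply filterdiff_ext_lin; [apply (filterdiff_const c)|].
  intros y; unfold zero, scal; simpl; unfold mult; simpl; ring.
Qed.

Lemma is_derive_within_mult (D : R -> Prop) f g t l m :
  D t -> is_derive_within D f t l -> is_derive_within D g t m ->
  is_derive_within D (fun s => f s * g s) t (l * g t + f t * m).
Proof.
  unfold is_derive_within; intros Dt Hf Hg.
  assert (PF : ProperFilter (within D (locally t))).
  { constructor.
    - intros P [d Hd]; exists t; apply Hd; [apply ball_center | exact Dt].
    - apply within_filter, locally_filter. }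
  assert (Ht : is_filter_lim (within D (locally t)) t).
  { intros P HP; unfold within; revert HP; apply filter_imp; auto. }
  assert (Cf := filterdiff_continuous_aux f (ex_intro _ _ Hf) t Ht).
  assert (Cg := filterdiff_continuous_aux g (ex_intro _ _ Hg) t Ht).
  eapply filterdiff_ext_lin.
  - apply (filterdiff_comp_2 f g Rmult _ _ (fun y z => plus (mult y (g t)) (mult (f t) z)) Hf Hg).
    apply (filterdiff_mult (K := R_AbsRing) (f t, g t)).
    + intros P [e He].
      pose proof (Cf _ (locally_ball (f t) e)) as Hf'.
      pose proof (Cg _ (locally_ball (g t) e)) as Hg'.
      unfold filtermap in *.
      refine (filter_imp (F := within D (locally t)) _ _ _ (filter_and _ _ Hf' Hg')).
      intros s [H1 H2]; apply He; split; assumption.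
    + intros; apply Rmult_comm.
  - intros y; unfold plus, scal; simpl; unfold mult; simpl; ring.
Qed.

Lemma is_derive_within_sum_n_m D (f : nat -> R -> R) l t n m :
  (forall j, (n <= j <= m)%nat -> is_derive_within D (f j) t (l j)) ->
  is_derive_within D (fun s => sum_n_m (fun j => f j s) n m) t (sum_n_m l n m).
Proof.
  induction m as [|m IH]; intros H.
  - destruct n as [|n].
    + eapply filterdiff_ext; [|rewrite sum_n_n; apply H; lia].
      intros s; now rewrite sum_n_n.
    + rewrite sum_n_m_zero by lia.
      eapply filterdiff_ext; [|apply is_derive_within_const].
      intros s; now rewrite sum_n_m_zero by lia.
  - destruct (Nat.le_gt_cases n (S m)) as [Hn|Hn].
    + rewrite sum_n_Sm by auto.
      eapply filterdiff_ext;
        [|apply is_derive_within_plus; [apply IH; intros; apply H; lia | apply (H (S m)); lia]].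
      intros s; now rewrite sum_n_Sm by auto.
    + rewrite sum_n_m_zero by lia.
      eapply filterdiff_ext; [|apply is_derive_within_const].
      intros s; now rewrite sum_n_m_zero by lia.
Qed.

Lemma RInt_sum_n (f : nat -> R -> R) k a b :
  (forall j, ex_RInt (f j) a b) ->
  ex_RInt (fun x => sum_n (fun j => f j x) k) a b /\
  RInt (fun x => sum_n (fun j => f j x) k) a b = sum_n (fun j => RInt (f j) a b) k.
Proof.
  intros Hf; induction k as [|k [IH1 IH2]].
  - rewrite sum_O; split.
    + apply ex_RInt_ext with (f 0%nat); [intros; now rewrite sum_O | auto].
    + apply RInt_ext; intros; now rewrite sum_O.
  - rewrite sum_Sn, <- IH2.
    assert (E : forall x, plus (sum_n (fun j => f j x) k) (f (S k) x)
                     = sum_n (fun j => f j x) (S k))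
      by (intros; now rewrite sum_Sn).
    split.
    + eapply ex_RInt_ext; [intros; apply E|].
      apply (ex_RInt_plus (fun x => sum_n (fun j => f j x) k)); auto.
    + rewrite <- (RInt_plus (V := R_CompleteNormedModule)) by auto.
      apply RInt_ext; intros; now rewrite E.
Qed.

(** Separates the time-dependent coefficients from fixed integrals, so that
    differentiating an inner product in time needs only sums and products. *)
Lemma RInt_pol_mult k c e a b :
  RInt (fun x => pol k c x * pol k e x) a b
  = sum_n (fun j => sum_n (fun l => c j * e l * RInt (fun x => x ^ (j + l)) a b) k) k.
Proof.
  assert (Ep : forall n, ex_RInt (fun x => x ^ n) a b).
  { intros n; apply (@ex_RInt_continuous R_CompleteNormedModule); intros z _.
    apply (ex_derive_continuous (fun x => x ^ n)); auto_derive; auto. }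
  set (f := fun j l x => (c j * e l) * x ^ (j + l)).
  assert (Ef : forall j l, ex_RInt (f j l) a b)
    by (intros; apply (ex_RInt_scal (fun x => x ^ (j + l))), Ep).
  transitivity (RInt (fun x => sum_n (fun j => sum_n (fun l => f j l x) k) k) a b).
  - apply RInt_ext; intros x _; unfold pol.
    change (sum_n (fun j => c j * x ^ j) k * sum_n (fun j => e j * x ^ j) k)
      with (mult (sum_n (fun j => c j * x ^ j) k) (sum_n (fun j => e j * x ^ j) k)).
    rewrite <- (sum_n_mult_r (K := R_Ring)); apply sum_n_ext; intros j.
    rewrite <- (sum_n_mult_l (K := R_Ring)); apply sum_n_ext; intros l.
    unfold f, mult; simpl; rewrite pow_add; ring.
  - rewrite (proj2 (RInt_sum_n (fun j x => sum_n (fun l => f j l x) k) k a b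
               (fun j => proj1 (RInt_sum_n (f j) k a b (Ef j))))).
    apply sum_n_ext; intros j; rewrite (proj2 (RInt_sum_n (f j) k a b (Ef j))).
    apply sum_n_ext; intros l; apply (RInt_scal (V := R_CompleteNormedModule)), Ep.
Qed.

Lemma is_derive_within_RInt_pol_sqr (D : R -> Prop) k (c c' : R -> nat -> R) a b t :
  D t -> (forall j, (j <= k)%nat -> is_derive_within D (fun s => c s j) t (c' t j)) ->
  is_derive_within D (fun s => RInt (fun x => pol k (c s) x * pol k (c s) x) a b) t
    (2 * RInt (fun x => pol k (c' t) x * pol k (c t) x) a b).
Proof.
  intros Dt Hc.
  eapply filterdiff_ext; [intros s; symmetry; apply RInt_pol_mult|].
  replace (2 * _) with
    (RInt (fun x => pol k (c' t) x * pol k (c t) x) a b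
     + RInt (fun x => pol k (c t) x * pol k (c' t) x) a b).
  2: { rewrite (RInt_ext (fun x => pol k (c t) x * pol k (c' t) x)
                 (fun x => pol k (c' t) x * pol k (c t) x)) by (intros; apply Rmult_comm).
       ring. }
  rewrite !RInt_pol_mult.
  change (Rplus ?x ?y) with (plus x y); rewrite <- sum_n_plus.
  apply is_derive_within_sum_n_m; intros j Hj.
  rewrite <- sum_n_plus.
  apply is_derive_within_sum_n_m; intros l Hl.
  set (m := RInt _ a b).
  eapply filterdiff_ext_lin.
  - apply is_derive_within_mult; [auto| |apply is_derive_within_const].
    apply is_derive_within_mult; [auto|apply Hc|apply Hc]; lia.
  - intros y; unfold plus, scal; simpl; unfold mult; simpl; ring.
Qed.

Lemma pol_C1 k c :
  (forall x, ex_derive (pol k c) x) /\ (forall x, continuous (Derive (pol k c)) x).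
Proof.
  assert (H : exists dp, (forall x, is_derive (pol k c) x (dp x)) /\ forall x, continuous dp x).
  { exists (fun x => sum_n (fun j => c j * (INR j * x ^ pred j)) k); split; intros x.
    - apply (is_derive_sum_n (fun j y => c j * y ^ j)); intros j _.
      auto_derive; auto; ring.
    - apply (ex_derive_continuous (fun x => sum_n (fun j => c j * (INR j * x ^ pred j)) k)).
      exists (sum_n (fun j => c j * (INR j * (INR (pred j) * x ^ pred (pred j)))) k).
      apply (is_derive_sum_n (fun j y => c j * (INR j * y ^ pred j))); intros j _.
      auto_derive; auto; ring. }
  destruct H as [dp [H1 H2]]; split; intros x.
  - now exists (dp x).
  - apply continuous_ext with dp; [|apply H2].
    intros y; symmetry; now apply is_derive_unique.
Qed.

(** * Energy balance of the scheme *)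

(** The scheme prescribes the reconstructed functions only on the closed element;
    the right-hand sides here are defined and regular on a neighbourhood of
    it. *)
Lemma reconstruction_prim_metric k N r S t i :
  local_reconstruction k N r S t -> (1 <= i <= N)%nat ->
  let a := r (i - 1)%nat in
  let wa := w_hat S t (i - 1)%nat in
  let za := z_hat S t (i - 1)%nat in
  let u := uh k S t i in
  let g := metric a (r i) wa (g_hat S t i) u in
  forall x, a <= x <= r i ->
    u_tilde k S t i x = avg a wa u x /\ gh S t i x = g x /\
    zh S t i x = prim a za g x /\ g_tilde S t i x = avg a za g x.
Proof.
  intros HR Hi a wa za u g.
  assert (Hut : forall x, a <= x <= r i -> u_tilde k S t i x = avg a wa u x).
  { intros x Hx; destruct (HR i Hi x Hx) as [Hw _].
    unfold u_tilde, avg, prim; rewrite Hw; reflexivity. }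
  assert (Hg : forall x, a <= x <= r i -> gh S t i x = g x).
  { intros x Hx; destruct (HR i Hi x Hx) as [_ [Hg _]]; rewrite Hg.
    unfold g, metric; do 3 f_equal; apply RInt_ext.
    rewrite Rmin_left, Rmax_right by lra; intros y Hy.
    unfold deviation; rewrite Hut by lra; reflexivity. }
  assert (Hz : forall x, a <= x <= r i -> zh S t i x = prim a za g x).
  { intros x Hx; destruct (HR i Hi x Hx) as [_ [_ Hz]]; rewrite Hz.
    unfold prim; f_equal; apply RInt_ext.
    fold a; rewrite Rmin_left, Rmax_right by lra; intros y Hy; apply Hg; lra. }
  intros x Hx; repeat split; auto.
  unfold g_tilde, avg; rewrite Hz, Hg by auto; reflexivity.
Qed.

(** Testing with [u_h] itself.  Integration by parts leaves
    [- g_tilde u^2 / 4] at the right end and [g_tilde u^2 / 4] at the left end.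
    The flux adds [g_tilde u_hat u / 2] on the right, which completes the square
    of the jump [u - u_hat], and [- g_tilde u^2 / 2] on the left, which makes
    that end dissipative. *)
Lemma element_estimate k N r S t i :
  local_reconstruction k N r S t -> local_evolution k N r S t -> (1 <= i <= N)%nat ->
  let a := r (i - 1)%nat in
  let b := r i in
  0 <= a < b -> (a = 0 -> w_hat S t (i - 1)%nat = 0) -> 0 <= g_hat S t i ->
  0 <= z_hat S t (i - 1)%nat <= a * gh S t i a ->
  (forall x, a <= x <= b -> 0 <= zh S t i x <= x * gh S t i x) /\
  inner r i (uh_t k S t i) (uh k S t i)
    + / 4 * (g_tilde S t i b * (uh k S t i b - u_hat S t i) ^ 2)
  <= / 4 * g_tilde S t i b * u_hat S t i ^ 2
     - / 4 * g_tilde S t i a * uh k S t i a ^ 2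
     + / 4 * (gh S t i b - gh S t i a).
Proof.
  intros HR HE Hi a b Hab Hw Hgb Hza.
  pose proof (reconstruction_prim_metric k N r S t i HR Hi) as P; simpl in P.
  fold a b in P.
  set (wa := w_hat S t (i - 1)%nat) in *; set (za := z_hat S t (i - 1)%nat) in *.
  set (u := uh k S t i) in *.
  set (g := metric a b wa (g_hat S t i) u) in *.
  destruct (P a ltac:(lra)) as (_ & Ga & _ & Ta).
  destruct (P b ltac:(lra)) as (_ & Gb & _ & Tb).
  rewrite Ga in Hza.
  destruct (pol_C1 k (uc S t i)) as [U1 U2].
  change (pol k (uc S t i)) with u in U1, U2.
  split.
  - intros x Hx; destruct (P x Hx) as (_ & -> & -> & _).
    apply prim_metric_bounds; auto; lra.
  - pose proof (element_energy a b wa (g_hat S t i) za u Hab Hw U1 U2 Hgb Hza) as K.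
    simpl in K; fold g in K.
    specialize (HE i Hi (uc S t i)); cbv zeta in HE.
    change (pol k (uc S t i)) with u in HE.
    unfold flux_right, flux_left in HE; fold a b u in HE.
    assert (E1 : inner r i (fun x => / 2 * g_tilde S t i x * u x) (Derive u)
                 = RInt (fun x => / 2 * avg a za g x * u x * Derive u x) a b).
    { apply RInt_ext; fold a b; rewrite Rmin_left, Rmax_right by lra; intros x Hx.
      destruct (P x ltac:(lra)) as (_ & _ & _ & ->); reflexivity. }
    assert (E2 : inner r i (fun x => / 2 * Derive (g_tilde S t i) x * u_tilde k S t i x) u
                 = RInt (fun x => / 2 * slope a za g x * avg a wa u x * u x) a b).
    { apply RInt_ext; fold a b; rewrite Rmin_left, Rmax_right by lra; intros x Hx.
      destruct (P x ltac:(lra)) as (-> & _ & _ & _).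
      replace (Derive (g_tilde S t i) x) with (slope a za g x); [reflexivity|].
      symmetry; apply is_derive_unique.
      apply is_derive_ext_loc with (avg a za g).
      - apply (filter_imp (fun y => a < y /\ y < b)).
        + intros y Hy; destruct (P y ltac:(lra)) as (_ & _ & _ & ->); reflexivity.
        + apply filter_and; [apply (open_gt a) | apply (open_lt b)]; lra.
      - apply is_derive_avg; [lra | | lra].
        intros y Hy; eapply is_derive_continuous, is_derive_metric; auto; lra. }
    rewrite E1, E2 in HE; rewrite Ta, Tb, Ga, Gb in *. nra.
Qed.

Lemma element_ends k N r S t i :
  local_reconstruction k N r S t -> (1 <= i <= N)%nat -> r (i - 1)%nat <= r i ->
  gh S t i (r i) = g_hat S t i /\ zh S t i (r (i - 1)%nat) = z_hat S t (i - 1)%nat.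
Proof.
  intros HR Hi Hr; split.
  - destruct (HR i Hi (r i) ltac:(lra)) as (_ & -> & _).
    rewrite RInt_point; change (@zero R_CompleteNormedModule) with 0.
    rewrite Ropp_0, exp_0; ring.
  - destruct (HR i Hi (r (i - 1)%nat) ltac:(lra)) as (_ & _ & ->).
    rewrite RInt_point; apply Rplus_0_r.
Qed.

Lemma partition_nonneg b N r i : partition b N r -> (i <= N)%nat -> 0 <= r i.
Proof.
  intros (_ & H0 & _ & Hr); induction i as [|i IH]; intros Hi; [lra|].
  specialize (Hr (S i) ltac:(lia)); replace (S i - 1)%nat with i in Hr by lia.
  specialize (IH ltac:(lia)); lra.
Qed.

(** The sign of [g] propagates from the outer boundary inwards: on each element
    [g] is its right trace times an exponential. *)
Lemma g_hat_nonneg k N r Ub S t b :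
  partition b N r -> local_reconstruction k N r S t -> transmission k N r S t ->
  boundary_data N Ub S t -> forall i, (1 <= i <= N)%nat -> 0 <= g_hat S t i.
Proof.
  intros (_ & _ & _ & Hr) HR HT (_ & HgN & _).
  enough (H : forall j i, (1 <= i)%nat -> (i + j = N)%nat -> 0 <= g_hat S t i).
  { intros i Hi; apply (H (N - i)%nat); lia. }
  induction j as [|j IH]; intros i Hi HN.
  - replace i with N by lia; lra.
  - assert (Ho := Hr i ltac:(lia)); assert (Hn := Hr (i + 1)%nat ltac:(lia)).
    replace (i + 1 - 1)%nat with i in Hn by lia.
    rewrite <- (proj1 (element_ends k N r S t i HR ltac:(lia) ltac:(lra))).
    destruct (HT i ltac:(lia)) as (_ & _ & _ & ->).
    destruct (HR (i + 1)%nat ltac:(lia) (r i)) as (_ & -> & _).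
    { replace (i + 1 - 1)%nat with i by lia; lra. }
    apply Rmult_le_pos; [apply IH; lia | left; apply exp_pos].
Qed.

(** The bound [0 <= z <= x g] propagates from the centre outwards, since [z] and
    [g] are continuous across the nodes; it supplies the hypothesis of
    [element_estimate] on each element in turn. *)
Lemma element_estimates b k N r Ub S t :
  partition b N r -> local_reconstruction k N r S t -> local_evolution k N r S t ->
  transmission k N r S t -> boundary_data N Ub S t ->
  forall i, (1 <= i <= N)%nat ->
  0 <= zh S t i (r i) <= r i * gh S t i (r i) /\
  inner r i (uh_t k S t i) (uh k S t i)
    + / 4 * (g_tilde S t i (r i) * (uh k S t i (r i) - u_hat S t i) ^ 2)
  <= / 4 * g_tilde S t i (r i) * u_hat S t i ^ 2
     - / 4 * g_tilde S t i (r (i - 1)%nat) * uh k S t i (r (i - 1)%nat) ^ 2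
     + / 4 * (gh S t i (r i) - gh S t i (r (i - 1)%nat)).
Proof.
  intros Hp HR HE HT HB.
  pose proof (g_hat_nonneg k N r Ub S t b Hp HR HT HB) as Hg.
  pose proof (partition_nonneg b N r) as Hr0.
  pose proof Hp as (_ & R0 & _ & Hr).
  destruct HB as (_ & _ & Hw0 & Hz0).
  induction i as [|i IH]; intros Hi; [lia|].
  assert (Ho := Hr (Datatypes.S i) Hi).
  assert (Hri := Hr0 i Hp ltac:(lia)).
  assert (Ei : (Datatypes.S i - 1)%nat = i) by lia.
  assert (Hw : r (Datatypes.S i - 1)%nat = 0 -> w_hat S t (Datatypes.S i - 1)%nat = 0).
  { rewrite Ei; intros E; destruct i as [|i]; [exact Hw0|].
    specialize (Hr (Datatypes.S i) ltac:(lia)).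
    replace (Datatypes.S i - 1)%nat with i in Hr by lia.
    pose proof (Hr0 i Hp ltac:(lia)); lra. }
  assert (Hz : 0 <= z_hat S t (Datatypes.S i - 1)%nat
               <= r (Datatypes.S i - 1)%nat * gh S t (Datatypes.S i) (r (Datatypes.S i - 1)%nat)).
  { rewrite Ei; destruct i as [|i]; [rewrite Hz0, R0; lra|].
    destruct (IH ltac:(lia)) as [Z _].
    destruct (HT (Datatypes.S i) ltac:(lia)) as (_ & _ & Tz & Tg).
    replace (Datatypes.S i + 1)%nat with (Datatypes.S (Datatypes.S i)) in * by lia.
    destruct (element_ends k N r S t _ HR Hi ltac:(lra)) as [_ Ez].
    rewrite Ei in Ez. rewrite <- Ez, <- Tg, <- Tz; exact Z. }
  rewrite Ei in Ho.
  destruct (element_estimate k N r S t (Datatypes.S i) HR HE Hi) as [K1 K2]; auto.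
  - rewrite Ei; lra.
  - split; [|exact K2]. apply K1; rewrite Ei; lra.
Qed.

(** The left end of an element contributes the negative of what the right end of
    its predecessor leaves over: multiplying the flux condition
    [g_tilde u_hat = g_tilde u] once by [u_hat] and once by the right-hand value
    [u] gives [g_tilde u_hat^2 = g_tilde u^2].  The increments of [g] telescope
    because [g] is continuous across the nodes. *)
Lemma energy_up_to_node b k N r Ub S t :
  partition b N r -> local_reconstruction k N r S t -> local_evolution k N r S t ->
  transmission k N r S t -> boundary_data N Ub S t ->
  let A := fun i => inner r i (uh_t k S t i) (uh k S t i) in
  let J := fun i => g_tilde S t i (r i) * (uh k S t i (r i) - u_hat S t i) ^ 2 in
  forall m, (1 <= m <= N)%nat ->
    sum_n_m A 1 m + / 4 * sum_n_m J 1 m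
    <= / 4 * g_tilde S t m (r m) * u_hat S t m ^ 2
       - / 4 * gh S t 1%nat 0 * uh k S t 1%nat 0 ^ 2
       + / 4 * (gh S t m (r m) - gh S t 1%nat 0).
Proof.
  intros Hp HR HE HT HB A J.
  pose proof (element_estimates b k N r Ub S t Hp HR HE HT HB) as Hest.
  pose proof Hp as (_ & R0 & _ & _).
  assert (Hg0 : g_tilde S t 1%nat (r 0%nat) = gh S t 1%nat 0).
  { rewrite R0; unfold g_tilde; destruct (Rlt_dec 0 0); [lra | reflexivity]. }
  induction m as [|m IH]; intros Hm; [lia|].
  destruct (Hest (Datatypes.S m) Hm) as [_ K].
  fold (A (Datatypes.S m)) (J (Datatypes.S m)) in K.
  rewrite !sum_n_Sm by lia; change (@plus R_AbelianMonoid) with Rplus.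
  replace (Datatypes.S m - 1)%nat with m in K by lia.
  destruct m as [|m].
  - rewrite !sum_n_m_zero by lia; change (@zero R_AbelianMonoid) with 0.
    rewrite Hg0, R0 in K. simpl in *; lra.
  - specialize (IH ltac:(lia)).
    destruct (HT (Datatypes.S m) ltac:(lia)) as (Tf & _ & Tz & Tg).
    unfold flux_right, flux_left in Tf.
    replace (Datatypes.S m + 1)%nat with (Datatypes.S (Datatypes.S m)) in * by lia.
    replace (Datatypes.S (Datatypes.S m) - 1)%nat with (Datatypes.S m) in Tf by lia.
    assert (Eg : g_tilde S t (Datatypes.S (Datatypes.S m)) (r (Datatypes.S m))
                 = g_tilde S t (Datatypes.S m) (r (Datatypes.S m))).
    { unfold g_tilde; rewrite Tz, Tg; reflexivity. }
    rewrite Eg in *. rewrite <- Tg in K.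
    set (gt := g_tilde S t (Datatypes.S m) (r (Datatypes.S m))) in *.
    set (uhat := u_hat S t (Datatypes.S m)) in *.
    set (ul := uh k S t (Datatypes.S (Datatypes.S m)) (r (Datatypes.S m))) in *.
    assert (Q : gt * uhat ^ 2 = gt * ul ^ 2).
    { assert (Q0 : gt * uhat = gt * ul) by lra.
      replace (gt * uhat ^ 2) with (gt * uhat * uhat) by ring.
      rewrite Q0; replace (gt * ul * uhat) with (gt * uhat * ul) by ring.
      rewrite Q0; ring. }
    lra.
Qed.

Theorem theorem3p1 (b T : R) (hb : 0 < b) (hT : 0 < T) (k N : nat)
    (r : nat -> R) (hr : partition b N r) (Ub : R -> R) (S : hdg_data)
    (hS : semidiscrete_solution T k N r Ub S) (t : R) (ht : 0 <= t <= T) :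
  (exists d : R,
     is_derive_within (time_interval T) (norm2_Th k N r S) t d /\
     / 2 * d + dissipation k N r Ub S t
       <= / 4 * Ub t ^ 2 + / 4 * (1 - gh S t 1%nat 0)) /\
  0 <= dissipation k N r Ub S t.
Proof.
  destruct hS as [HC HS]; destruct (HS t ht) as (HR & HE & HT & HB).
  pose proof (element_estimates b k N r Ub S t hr HR HE HT HB) as Hest.
  pose proof (g_hat_nonneg k N r Ub S t b hr HR HT HB) as Hg.
  pose proof (partition_nonneg b N r) as Hr0.
  pose proof hr as (HN & R0 & _ & Hr).
  pose proof HB as (HuN & HgN & _ & _).
  assert (Hrpos : forall i, (1 <= i <= N)%nat -> 0 < r i).
  { intros i Hi; specialize (Hr i Hi); pose proof (Hr0 (i - 1)%nat hr ltac:(lia)); lra. }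
  assert (Hgt : forall i, (1 <= i <= N)%nat -> g_tilde S t i (r i) = zh S t i (r i) / r i).
  { intros i Hi; specialize (Hrpos i Hi); unfold g_tilde.
    destruct (Rlt_dec 0 (r i)); [reflexivity | contradiction]. }
  assert (Hgt0 : forall i, (1 <= i <= N)%nat -> 0 <= g_tilde S t i (r i)).
  { intros i Hi; rewrite Hgt by auto; specialize (Hrpos i Hi).
    destruct (Hest i Hi) as [Z _].
    apply Rmult_le_pos; [lra | left; now apply Rinv_0_lt_compat]. }
  assert (HgtN : g_tilde S t N (r N) <= 1).
  { assert (Hi : (1 <= N <= N)%nat) by lia.
    specialize (Hrpos N Hi); rewrite Hgt by auto.
    destruct (Hest N Hi) as [[_ Z] _]; specialize (Hr N Hi).
    rewrite (proj1 (element_ends k N r S t N HR Hi ltac:(lra))), HgN in Z.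
    apply Rmult_le_reg_r with (r N); [auto|]. field_simplify; lra. }
  assert (Hg1 : 0 <= gh S t 1%nat 0).
  { destruct (HR 1%nat ltac:(lia) 0) as (_ & -> & _).
    - simpl; rewrite R0; pose proof (Hrpos 1%nat ltac:(lia)); lra.
    - apply Rmult_le_pos; [apply Hg; lia | left; apply exp_pos]. }
  set (J := fun i => g_tilde S t i (r i) * (uh k S t i (r i) - u_hat S t i) ^ 2).
  assert (HJ : forall i, (1 <= i <= N)%nat -> 0 <= J i).
  { intros i Hi; apply Rmult_le_pos; [auto | apply pow2_ge_0]. }
  assert (HsumJ : forall m, (m <= N)%nat -> 0 <= sum_n_m J 1 m).
  { induction m as [|m IH]; intros Hm.
    - rewrite sum_n_m_zero by lia; apply Rle_refl.
    - rewrite sum_n_Sm by lia; apply Rplus_le_le_0_compat; [apply IH; lia | apply HJ; lia]. }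
  set (A := fun i => inner r i (uh_t k S t i) (uh k S t i)).
  pose proof (energy_up_to_node b k N r Ub S t hr HR HE HT HB) as Htel;
    cbv zeta in Htel; fold A J in Htel.
  (* The boundary term of the dissipation is the jump term of the last node, as
     [u_hat] equals the boundary datum there. *)
  assert (HD : dissipation k N r Ub S t
    = / 4 * gh S t 1%nat 0 * uh k S t 1%nat 0 ^ 2 + / 4 * sum_n_m J 1 N).
  { unfold dissipation; fold J; rewrite <- HuN.
    replace (sum_n_m J 1 N) with (sum_n_m J 1 (N - 1) + J N).
    - unfold J at 3; ring.
    - destruct N as [|n]; [lia|]. rewrite sum_n_Sm by lia.
      replace (Datatypes.S n - 1)%nat with n by lia; reflexivity. }
  split.
  - exists (sum_n_m (fun i => 2 * A i) 1 N); split.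
    + apply is_derive_within_sum_n_m; intros i Hi.
      apply (is_derive_within_RInt_pol_sqr _ k (fun s => uc S s i) (fun s => utc S s i));
        [exact ht|].
      intros j Hj; exact (proj1 (HC i j Hi Hj) t ht).
    + assert (E : sum_n_m (fun i => 2 * A i) 1 N = 2 * sum_n_m A 1 N)
        by exact (sum_n_m_mult_l (K := R_Ring) 2 A 1 N).
      rewrite E, HD.
      specialize (Htel N ltac:(lia)).
      rewrite (proj1 (element_ends k N r S t N HR ltac:(lia)
                        ltac:(left; apply Hr; lia))), HgN, HuN in Htel.
      pose proof (Rmult_le_compat_r (Ub t ^ 2) _ _ (pow2_ge_0 (Ub t)) HgtN).
      lra.
  - rewrite HD; specialize (HsumJ N ltac:(lia)).
    pose proof (Rmult_le_pos _ _ Hg1 (pow2_ge_0 (uh k S t 1%nat 0))); lra.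
Qed.
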